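(* Let $\mathcal{R}\in\mathbb{R}^{d\times d}$ be a skew-symmetric matrix with $[\mathbb{W},\mathcal{R}]=\mathbb{W}\mathcal{R}-\mathcal{R}\mathbb{W}=O$. The charge $Q_\Lambda=-\frac12\mathbf{y}^T(\mathcal{J}\otimes\mathcal{R})\mathbf{y}$ is a quadratic integral invariant of the system $$\frac{\partial\mathbf{y}(t)}{\partial t}=\mathcal{E}(t,\mathbf{y}(t))\,\mathbf{y}(t),\qquad t\in(t_0,T]$$ (i.e. it is constant along every solution), and it is preserved by the implicit midpoint method: if $N$ is a positive integer, $h=(T-t_0)/N$, $t_k=t_0+kh$, and $\mathbf{y}^{(0)},\dots,\mathbf{y}^{(N)}\in\mathbb{R}^{2nd}$ satisfy $$\mathbf{y}^{(k+1)}=\mathbf{y}^{(k)}+h\,\mathcal{E}\!\left(t_k+\tfrac h2,\ \frac{\mathbf{y}^{(k+1)}+\mathbf{y}^{(k)}}{2}\right)\frac{\mathbf{y}^{(k+1)}+\mathbf{y}^{(k)}}{2},\qquad k=0,\dots,N-1,$$ then $$(\mathbf{y}^{(k+1)})^T(\mathcal{J}\otimes\mathcal{R})\,\mathbf{y}^{(k+1)}=(\mathbf{y}^{(k)})^T(\mathcal{J}\otimes\mathcal{R})\,\mathbf{y}^{(k)}\qquad\text{for all }k=0,\dots,N-1.$$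
   Context: Let $n,d,d'$ be positive integers, $\hat n=nd$, $\epsilon>0$, $t_0<T$ real. $\mathcal{V}=\{1,\dots,n\}$ is the node set of an undirected graph without self-loops, with matrix $w=(w_{ij})$, $w_{ij}=1$ if $(i,j)$ is an edge and $w_{ij}=0$ otherwise; thus $w_{ij}=w_{ji}$ and $w_{ii}=0$. $W_K,W_Q\in\mathbb{R}^{d'\times d}$ are fixed matrices and $\mathbb{W}=W_K^TW_Q+W_Q^TW_K$, a symmetric $d\times d$ matrix. $g:\mathbb{R}\to\mathbb{R}$ is a differentiable activation function with derivative $g'$. Write $\mathbf{y}=(\mathbf{x}_1^T,\dots,\mathbf{x}_n^T,\mathbf{p}_1^T,\dots,\mathbf{p}_n^T)^T\in\mathbb{R}^{2\hat n}$ with $\mathbf{x}_i,\mathbf{p}_i\in\mathbb{R}^d$. $\mathcal{C}(\mathbf{y})$ is the $\hat n\times\hat n$ matrix consisting of $n\times n$ blocks of size $d\times d$ given, for $r,s=1,\dots,n$, by $$\big(\mathcal{C}(\mathbf{y})\big)_{rr}=-2I_d\sum_{i\in\mathcal{V},\,i\ne r}w_{ri}\,g(\mathbf{x}_r^T\mathbb{W}\mathbf{x}_i),$$ $$\big(\mathcal{C}(\mathbf{y})\big)_{rs}=w_{rs}\Big(2I_d\,g(\mathbf{x}_r^T\mathbb{W}\mathbf{x}_s)-\mathbb{W}\,g'(\mathbf{x}_r^T\mathbb{W}\mathbf{x}_s)\,\|\mathbf{x}_r-\mathbf{x}_s\|^2\Big)\quad(r\neq s),$$ where $\|\cdot\|$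 is the Euclidean norm. The system matrix is $$\mathcal{E}(t,\mathbf{y})=\begin{pmatrix}O&e^{t/\epsilon}I_{\hat n}\\-\frac{e^{-t/\epsilon}}{\epsilon}\,\mathcal{C}(\mathbf{y})&O\end{pmatrix}.$$ $I_m$ is the identity matrix of order $m$, $O$ is a zero matrix, $\otimes$ is the Kronecker product, and $\mathcal{J}=\begin{pmatrix}O&I_n\\-I_n&O\end{pmatrix}\in\mathbb{R}^{2n\times 2n}$. Equivalently, the charge is $Q_\Lambda=\sum_{i\in\mathcal{V}}\mathbf{p}_i^T\mathcal{R}\,\mathbf{x}_i$. *)

(* Defs.v *)
(* The Kronecker product [*t] is that of mxtens, in mathcomp-real-closed. *)
From mathcomp Require Export all_boot all_order all_algebra.
From mathcomp Require Export all_classical all_reals all_analysis.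
From mathcomp Require Export mxtens.
Export Order.TTheory GRing.Theory Num.Theory numFieldNormedType.Exports.

Set Implicit Arguments.
Unset Strict Implicit.
Unset Printing Implicit Defensive.

Local Open Scope classical_set_scope.
Local Open Scope ring_scope.

(* The norm that the library puts on matrices is the sup norm. *)
Definition enorm {R : realType} {m : nat} (u : 'cV[R]_m) : R :=
  Num.sqrt (\sum_(i < m) u i 0 ^+ 2).

Definition adjacency (R : realType) {n : nat} (e : rel 'I_n) : 'M[R]_n :=
  \matrix_(i, j) (e i j)%:R.

Definition bbW {R : realType} {d d' : nat} (WK WQ : 'M[R]_(d', d)) : 'M[R]_d :=
  WK^T *m WQ + WQ^T *m WK.

(* A vector of 'cV_(n * d) is read as n stacked vectors of size d, in the index
   order of [*t]: entry j of the i-th one is at mxtens_index (i, j), whose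
   value is i * d + j. A state is the column vector col_mx x p. *)
Definition nodevec {R : realType} {n d : nat} (x : 'cV[R]_(n * d)) (i : 'I_n) :
  'cV[R]_d := \col_j x (mxtens_index (i, j)) 0.

Definition nodeblocks {R : realType} {n d : nat} (B : 'I_n -> 'I_n -> 'M[R]_d) :
  'M[R]_(n * d) :=
  \matrix_(a, b) B (mxtens_unindex a).1 (mxtens_unindex b).1
                   (mxtens_unindex a).2 (mxtens_unindex b).2.

Section System.
Context {R : realType} {n d : nat}.
Variables (w : 'M[R]_n) (W : 'M[R]_d) (g : R -> R) (eps : R).

Definition Cblock (x : 'cV[R]_(n * d)) (r s : 'I_n) : 'M[R]_d :=
  let X := nodevec x in
  let a i j := ((X i)^T *m W *m X j) 0 0 in
  if r == s then - 2 * (\sum_(i < n | i != r) w r i * g (a r i)) *: 1%:M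
  else w r s *: ((2 * g (a r s)) *: 1%:M
                 - (derive1 g (a r s) * enorm (X r - X s) ^+ 2) *: W).

Definition Cmx (y : 'cV[R]_(n * d + n * d)) : 'M[R]_(n * d) :=
  nodeblocks (Cblock (usubmx y)).

Definition Emx (t : R) (y : 'cV[R]_(n * d + n * d)) :
  'M[R]_(n * d + n * d) :=
  block_mx 0 (expR (t / eps) *: 1%:M)
           (- (expR (- t / eps) / eps) *: Cmx y) 0.

End System.

Definition Jmx (R : realType) (n : nat) : 'M[R]_(n + n) :=
  block_mx 0 1%:M (- 1%:M) 0.

(* The Kronecker product of J and L; the cast only identifies the dimension
   (n + n) * d with n * d + n * d and does not move any entry. *)
Definition JtensL {R : realType} {n d : nat} (L : 'M[R]_d) :
  'M[R]_(n * d + n * d) :=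
  castmx (mulnDl n n d, mulnDl n n d) (Jmx R n *t L).

Definition qcharge {R : realType} {n d : nat} (L : 'M[R]_d)
  (y : 'cV[R]_(n * d + n * d)) : R :=
  - 2^-1 * (y^T *m JtensL L *m y) 0 0.

(* y is a solution on ]t0, T] of y'(t) = E(t, y(t)) y(t). The derivative is the
   limit of difference quotients taken inside ]t0, T], so it is two-sided at
   t < T and the left derivative at t = T. *)
Definition solution {R : realType} {m : nat} (t0 T : R)
  (E : R -> 'cV[R]_m -> 'M[R]_m) (y : R -> 'cV[R]_m) : Prop :=
  forall t, t0 < t <= T ->
    h^-1 *: (y (t + h) - y t)
      @[h --> within [set h | t0 < t + h <= T] 0^'] --> E t (y t) *m y t.

Definition midpoint_step {R : realType} {m : nat}
  (E : R -> 'cV[R]_m -> 'M[R]_m) (h t : R) (u v : 'cV[R]_m) : Prop :=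
  v = u + h *: (E (t + h / 2) (2^-1 *: (v + u)) *m (2^-1 *: (v + u))).

(* Main.v *)
(* Write M for the Kronecker product of J and L. As J and L are skew, M is
   symmetric, so the quadratic form of M has derivative 2 y^T M y' along a
   curve, and v^T M v - u^T M u = (v + u)^T M (v - u) along a step. Both vanish
   because M E(t, y) is skew: its diagonal blocks are multiples of A and of A C,
   with A = I (x) L; A is skew, C is symmetric since g is evaluated at a
   symmetric function of the two nodes, and they commute since every block of C
   is a combination of the identity and W. *)
Require Import Defs.
From mathcomp Require Import lra.

Local Open Scope classical_set_scope.
Local Open Scope ring_scope.

(** * Quadratic forms of skew and symmetric matrices *)

Lemma trmx11 (T : Type) (A : 'M[T]_1) : A^T = A.
Proof. by apply/matrixP => i j; rewrite !ord1 mxE. Qed.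

Lemma skew_form_eq0 (R : realType) m (S : 'M[R]_m) (x : 'cV[R]_m) :
  S^T = - S -> x^T *m S *m x = 0.
Proof.
move=> Sskew.
have xSx : x^T *m S *m x = - (x^T *m S *m x).
  by rewrite -[LHS]trmx11 !trmx_mul trmxK Sskew mulNmx mulmxN mulmxA.
apply/matrixP => i j; have /matrixP/(_ i j) := xSx; rewrite !mxE; lra.
Qed.

Lemma sym_formC (R : realType) m (M : 'M[R]_m) (u v : 'cV[R]_m) :
  M^T = M -> u^T *m M *m v = v^T *m M *m u.
Proof.
by move=> Msym; rewrite -[LHS]trmx11 !trmx_mul trmxK Msym mulmxA.
Qed.

(** On expanding the right-hand side the cross terms cancel by symmetry of [M]. Being exact, this
    difference of squares serves both the difference quotients of the flow and the midpoint step. *)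
Lemma sym_formB (R : realType) m (M : 'M[R]_m) (u v : 'cV[R]_m) :
  M^T = M ->
  v^T *m M *m v - u^T *m M *m u = (v + u)^T *m M *m (v - u).
Proof.
move=> Msym; rewrite [(v + u)^T]raddfD/= mulmxDl mulmxDl !mulmxBr.
by rewrite (sym_formC _ _ _ v u Msym) addrA subrK.
Qed.

(** * Kronecker products as block matrices *)

Lemma nodeblocksE (R : realType) n d (B : 'I_n -> 'I_n -> 'M[R]_d) i k j l :
  nodeblocks B (mxtens_index (i, j)) (mxtens_index (k, l)) = B i k j l.
Proof. by rewrite mxE !mxtens_indexK. Qed.

Lemma mul_tens_nodeblocks (R : realType) n d (L : 'M[R]_d)
    (B : 'I_n -> 'I_n -> 'M[R]_d) :
  (1%:M *t L) *m nodeblocks B = nodeblocks (fun r s => L *m B r s).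
Proof.
apply/matrixP => a b.
case: (mxtens_indexP a) => i j; case: (mxtens_indexP b) => k l.
rewrite nodeblocksE !mxE.
rewrite (reindex (@mxtens_index n d)) /=; last first.
  by exists (@mxtens_unindex n d) => ? _;
    [exact: mxtens_indexK|exact: mxtens_unindexK].
rewrite (eq_bigr (fun p => (i == p.1)%:R * (L j p.2 * B p.1 k p.2 l)));
  last first.
  by move=> -[i' j'] _; rewrite tensmxE nodeblocksE mxE mulrA.
(* Since [1%:M *t L] is block diagonal, only the node [i' = i] survives in the double sum. *)
rewrite -(pair_bigA _ (fun i' j' => (i == i')%:R * (L j j' * B i' k j' l))) /=.
rewrite (bigD1 i) //= [X in _ + X]big1 ?addr0; last first.
  by move=> i' /negPf ii'; rewrite big1// => j' _; rewrite eq_sym ii' mul0r.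
by apply: eq_bigr => j' _; rewrite eqxx mul1r.
Qed.

Lemma JtensLE (R : realType) (n d : nat) (L : 'M[R]_d) :
  @JtensL R n d L = block_mx 0 (1%:M *t L) (- (1%:M *t L)) 0.
Proof.
(* [keyl] and [keyr] locate the two halves of a state among the [n + n] nodes: position [c] of the
   upper half keeps its node, and position [n * d + c] belongs to node [n + c %/ d], with the same
   offset [c %% d]. *)
have keyl (c : 'I_(n * d)) :
    mxtens_unindex (cast_ord (esym (mulnDl n n d)) (lshift _ c)) =
    (lshift n (mxtens_unindex c).1, (mxtens_unindex c).2).
  apply: (can_inj (@mxtens_indexK _ _)); rewrite mxtens_unindexK.
  by apply: val_inj => /=; exact: divn_eq.
have keyr (c : 'I_(n * d)) :
    mxtens_unindex (cast_ord (esym (mulnDl n n d)) (rshift _ c)) =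
    (rshift n (mxtens_unindex c).1, (mxtens_unindex c).2).
  apply: (can_inj (@mxtens_indexK _ _)); rewrite mxtens_unindexK.
  by apply: val_inj => /=; rewrite mulnDl -addnA -divn_eq.
apply/matrixP => a b; rewrite castmxE mxE /Jmx.
have [a' ->|a' ->] := split_ordP a; have [b' ->|b' ->] := split_ordP b.
- by rewrite !keyl !block_mxEul !mxE mul0r.
- by rewrite keyl keyr !block_mxEur [RHS]mxE.
- by rewrite keyl keyr !block_mxEdl !mxE mulNr.
- by rewrite !keyr !block_mxEdr !mxE mul0r.
Qed.

(** * Limits and difference quotients *)

Lemma cvg_form (R : realType) (T : Type) (F : set_system T) m (M : 'M[R]_m)
    (f g : T -> 'cV[R]_m) (a b : 'cV[R]_m) :
  Filter F -> f @ F --> a -> g @ F --> b ->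
  ((f x)^T *m M *m g x) 0 0 @[x --> F] --> (a^T *m M *m b) 0 0.
Proof.
move=> FF fa gb.
have coord (k : T -> 'cV[R]_m) (c : 'cV[R]_m) i : k @ F --> c ->
    k x i 0 @[x --> F] --> c i 0.
  by move=> kc; exact: (continuous_cvg _ (@coord_continuous R m 1 i 0 c) kc).
rewrite mxE; under eq_fun do rewrite mxE.
apply: cvg_big => [|j _]; first exact: add_continuous.
apply: cvgM; last exact: coord.
rewrite mxE; under eq_fun do rewrite mxE.
apply: cvg_big => [|i _]; first exact: add_continuous.
apply: cvgM; last exact: cvg_cst.
by rewrite mxE; under eq_fun do rewrite mxE; exact: coord.
Qed.

(** Differentiability implies continuity, relative to [A]: the quotient times [h] tends to
    [0 *: l]. *)
Lemma diff_quotient_cvg (R : realType) (V : normedModType R) (A : set R)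
    (f : R -> V) (t : R) (l : V) :
  h^-1 *: (f (t + h) - f t) @[h --> within A 0^'] --> l ->
  f (t + h) @[h --> within A 0^'] --> f t.
Proof.
move=> fl; apply/subr_cvg0.
have h0 : h @[h --> within A (0 : R)^'] --> (0 : R).
  apply: (@cvg_within_filter R R id 0^').
  exact: (@cvg_within_filter R R id (nbhs 0)).
have hl : h *: (h^-1 *: (f (t + h) - f t)) @[h --> within A 0^'] --> (0 : V).
  by rewrite -(scale0r l); exact: cvgZ.
apply: cvg_trans hl; apply: near_eq_cvg.
near=> h; rewrite scalerA divff ?scale1r//.
near: h; rewrite !near_withinE; exact: nearW.
Unshelve. all: by end_near. Qed.

(** The mean value theorem on [[s, t]]. It asks for two-sided derivatives only inside, so the
    one-sided limit at [b] need only give continuity there. *)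
Lemma zero_diff_quotient_cst (R : realType) (a b : R) (f : R -> R) :
  (forall t, a < t <= b ->
    h^-1 *: (f (t + h) - f t) @[h --> within [set h | a < t + h <= b] 0^']
      --> (0 : R)) ->
  forall s t, a < s <= b -> a < t <= b -> f s = f t.
Proof.
move=> df; suff main s t : a < s -> s < t -> t <= b -> f s = f t.
  move=> s t /andP[ls sb] /andP[lt tb].
  have [st|ts|->//] := ltgtP s t; first exact: main.
  by rewrite (main t s).
move=> ls st tb.
have drv x : x \in `]s, t[ -> is_derive x 1 f 0.
  rewrite in_itv/= => /andP[sx xt].
  have cv : h^-1 *: (f (h *: 1 + x) - f x) @[h --> 0^'] --> (0 : R).
    have axb : a < x <= b by rewrite (lt_trans ls)//= (le_trans (ltW xt)).
    (* At an interior point the constraint on [x + h] holds for all small [h], so the restricted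
       limit is the ordinary derivative. *)
    have nD : \forall h \near (0 : R)^', a < x + h <= b.
      apply: nbhs_dnbhs; apply: (iffLR (nbhs0P (fun z => a < z <= b) x)).
      have xab : x \in `]a, b[.
        by rewrite in_itv/= (lt_trans ls)//= (lt_le_trans xt).
      apply: filterS (near_in_itvoo xab) => z.
      by rewrite in_itv/= => /andP[-> /ltW].
    under eq_fun do rewrite [_ *: 1]mulr1 (addrC _ x).
    have := df _ axb; apply: cvg_trans; apply: cvg_app => P /= HP.
    by apply: filterS2 nD HP => h Dh /(_ Dh).
  apply: DeriveDef; first by apply/cvg_ex; exists 0.
  exact/cvg_lim.
have cf : {within `[s, t], continuous f}.
  apply/subspace_continuousP => x /=; rewrite in_itv/= => /andP[sx xt].
  have axb : a < x <= b by rewrite (lt_le_trans ls)//= (le_trans xt).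
  have /cvgrPdist_lt fx := diff_quotient_cvg _ _ _ _ _ _ (df _ axb).
  apply/cvgrPdist_lt => e e0; rewrite near_withinE.
  apply: (iffRL (nbhs0P _ x)).
  have := fx _ e0; rewrite !near_withinE; apply: filterS => h fh.
  rewrite /= in_itv/= => /andP[sxh xht].
  (* The limit over [0^'] says nothing at [h = 0], where the bound is trivial. *)
  have [->|h0] := eqVneq h 0; first by rewrite addr0 subrr normr0.
  by apply: fh => //=; rewrite (lt_le_trans ls)//= (le_trans xht).
have [c _ /eqP] := MVT st drv cf.
by rewrite mul0r subr_eq0 => /eqP.
Unshelve. all: by end_near. Qed.

(** * Quadratic invariants when [M *m E t u] is skew *)

Lemma skew_flow_invariant (R : realType) m (M : 'M[R]_m)
    (E : R -> 'cV[R]_m -> 'M[R]_m) (t0 T : R) (y : R -> 'cV[R]_m) :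
  M^T = M -> (forall t u, (M *m E t u)^T = - (M *m E t u)) ->
  solution t0 T E y ->
  forall s t, t0 < s <= T -> t0 < t <= T ->
    ((y s)^T *m M *m y s) 0 0 = ((y t)^T *m M *m y t) 0 0.
Proof.
move=> Msym MEskew ysol.
apply: (zero_diff_quotient_cst R t0 T (fun t => ((y t)^T *m M *m y t) 0 0)).
move=> t /ysol dy.
have yc := diff_quotient_cvg _ _ _ _ _ _ dy.
have y2 : y (t + h) + y t @[h --> within [set h | t0 < t + h <= T] 0^']
    --> y t + y t by apply: cvgD => //; exact: cvg_cst.
(* The limit of the difference quotient of the form is twice a skew form evaluated at [y t]. *)
have form0 : ((y t + y t)^T *m M *m (E t (y t) *m y t)) 0 0 = 0 :> R.
  rewrite -mulr2n -scaler_nat linearZ/= -!scalemxAl -mulmxA (mulmxA M).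
  by rewrite mulmxA skew_form_eq0// scaler0 mxE.
(* By [sym_formB] this expression is the difference quotient of the quadratic form, so no product
   rule is invoked. *)
have cv : ((y (t + h) + y t)^T *m M *m (h^-1 *: (y (t + h) - y t))) 0 0
    @[h --> within [set h | t0 < t + h <= T] 0^']
    --> ((y t + y t)^T *m M *m (E t (y t) *m y t)) 0 0 by exact: cvg_form.
rewrite form0 in cv; apply: cvg_trans cv; apply: near_eq_cvg; apply: nearW => h.
by rewrite -scalemxAr mxE -sym_formB// [in LHS]mxE [in X in _ * (_ + X)]mxE.
Qed.

(** With [c] the midpoint, [v + u] is [2 *: c] and [v - u] is [h] times [E] applied to the same [c],
    so the increment is a multiple of a skew form at [c]. *)
Lemma skew_flow_midpoint_invariant (R : realType) m (M : 'M[R]_m)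
    (E : R -> 'cV[R]_m -> 'M[R]_m) (h t : R) (u v : 'cV[R]_m) :
  M^T = M -> (forall t u, (M *m E t u)^T = - (M *m E t u)) ->
  midpoint_step E h t u v -> v^T *m M *m v = u^T *m M *m u.
Proof.
move=> Msym MEskew step; apply/eqP; rewrite -subr_eq0 sym_formB//.
(* Only the [v] of [v - u] is unfolded; [v + u] must stay intact to become [2 *: c]. *)
rewrite {2}step addrAC subrr add0r.
set c := 2^-1 *: (v + u).
have -> : v + u = 2 *: c by rewrite scalerA divff ?scale1r// pnatr_eq0.
rewrite [(2 *: c)^T]linearZ/= -!scalemxAl -scalemxAr -mulmxA (mulmxA M).
by rewrite mulmxA skew_form_eq0// !scaler0.
Qed.

(** * Skewness for the graph system *)

Lemma tens1mx_skew (R : realType) (n d : nat) (L : 'M[R]_d) :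
  L^T = - L -> (1%:M *t L)^T = - (1%:M *t L) :> 'M[R]_(n * d).
Proof.
move=> Lskew; rewrite trmx_tens trmx1 Lskew.
by apply/matrixP => i j; rewrite !mxE mulrN.
Qed.

Lemma JtensL_sym (R : realType) (n d : nat) (L : 'M[R]_d) :
  L^T = - L -> (@JtensL R n d L)^T = JtensL L.
Proof.
move=> Lskew.
by rewrite JtensLE tr_block_mx !trmx0 linearN/= tens1mx_skew// opprK.
Qed.

(** Blockwise form of the symmetry of [Cmx]: the weight, the argument of [g] and the distance are
    symmetric in [r] and [s], and the matrices [1%:M] and [W] are symmetric. *)
Lemma Cblock_sym (R : realType) (n d : nat) (w : 'M[R]_n) (W : 'M[R]_d)
    (g : R -> R) (x : 'cV[R]_(n * d)) (r s : 'I_n) :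
  w^T = w -> W^T = W -> (Cblock w W g x s r)^T = Cblock w W g x r s.
Proof.
move=> wsym Wsym; rewrite /Cblock eq_sym; case: eqVneq => [->|_].
  by rewrite linearZ/= trmx1.
rewrite linearZ/= linearB/= !linearZ/= trmx1 Wsym.
rewrite -[w in LHS]wsym mxE (sym_formC _ _ W) //.
have -> : enorm (nodevec x s - nodevec x r) = enorm (nodevec x r - nodevec x s).
  by congr Num.sqrt; apply: eq_bigr => i _; rewrite !mxE -sqrrN opprB.
by [].
Qed.

Lemma Cblock_comm (R : realType) (n d : nat) (w : 'M[R]_n) (W L : 'M[R]_d)
    (g : R -> R) (x : 'cV[R]_(n * d)) (r s : 'I_n) :
  W *m L = L *m W -> Cblock w W g x r s *m L = L *m Cblock w W g x r s.
Proof.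
move=> WL; rewrite /Cblock; case: eqP => _.
  by rewrite -scalemxAl -scalemxAr mul1mx mulmx1.
rewrite -scalemxAl -scalemxAr mulmxBl mulmxBr -!scalemxAl -!scalemxAr.
by rewrite mul1mx mulmx1 WL.
Qed.

Lemma JtensL_Emx_skew (R : realType) (n d : nat) (w : 'M[R]_n)
    (W L : 'M[R]_d) (g : R -> R) (eps t : R) (y : 'cV[R]_(n * d + n * d)) :
  w^T = w -> W^T = W -> L^T = - L -> W *m L = L *m W ->
  (JtensL L *m Emx w W g eps t y)^T = - (JtensL L *m Emx w W g eps t y).
Proof.
move=> wsym Wsym Lskew WL.
have Cskew : ((1%:M *t L) *m Cmx w W g y)^T = - ((1%:M *t L) *m Cmx w W g y).
  rewrite /Cmx mul_tens_nodeblocks; apply/matrixP => a b.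
  case: (mxtens_indexP a) => i j; case: (mxtens_indexP b) => k l.
  rewrite mxE nodeblocksE [RHS]mxE nodeblocksE.
  (* Blockwise, with [C] for [Cblock]: [(L C_ki)^T = C_ki^T L^T = - C_ik L = - L C_ik]. *)
  transitivity ((L *m Cblock w W g (usubmx y) k i)^T j l).
    by rewrite [RHS]mxE.
  by rewrite trmx_mul Cblock_sym// Lskew mulmxN Cblock_comm// !mxE.
rewrite JtensLE /Emx mulmx_block !mul0mx !mulmx0 !addr0 !add0r.
rewrite tr_block_mx opp_block_mx !trmx0 oppr0.
rewrite -!scalemxAr mulmx1 !linearZ/= Cskew [(- (1%:M *t L))^T]linearN/=.
by rewrite (tens1mx_skew _ _ _ _ Lskew) !scalerN opprK.
Qed.

Theorem proposition3 (R : realType) (n d d' : nat) (eps t0 T : R)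
  (e : rel 'I_n) (WK WQ : 'M[R]_(d', d)) (g : R -> R) (L : 'M[R]_d)
  (n_gt0 : (0 < n)%N) (d_gt0 : (0 < d)%N) (d'_gt0 : (0 < d')%N)
  (eps_gt0 : 0 < eps) (t0_lt_T : t0 < T)
  (e_sym : symmetric e) (e_irr : irreflexive e)
  (g_diff : forall u : R, derivable g u 1)
  (L_skew : L^T = - L)
  (L_comm : bbW WK WQ *m L - L *m bbW WK WQ = 0) :
  let E := Emx (adjacency R e) (bbW WK WQ) g eps in
  (forall y : R -> 'cV[R]_(n * d + n * d),
     solution t0 T E y ->
     (forall s t : R, t0 < s <= T -> t0 < t <= T ->
        qcharge L (y s) = qcharge L (y t)) /\
     (y t @[t --> t0^'+] --> y t0 ->
      forall t : R, t0 <= t <= T -> qcharge L (y t) = qcharge L (y t0))) /\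
  (forall (N : nat) (y : nat -> 'cV[R]_(n * d + n * d)),
     (0 < N)%N ->
     let h := (T - t0) / N%:R in
     (forall k : nat, (k < N)%N ->
        midpoint_step E h (t0 + k%:R * h) (y k) (y k.+1)) ->
     forall k : nat, (k < N)%N ->
       (y k.+1)^T *m JtensL L *m y k.+1 = (y k)^T *m JtensL L *m y k).
Proof.
move=> E.
have wsym : (adjacency R e)^T = adjacency R e.
  by apply/matrixP => i j; rewrite !mxE e_sym.
have Wsym : (bbW WK WQ)^T = bbW WK WQ.
  by rewrite linearD/= !trmx_mul !trmxK addrC.
have /eqP := L_comm; rewrite subr_eq0 => /eqP WL.
have Msym := JtensL_sym _ n _ _ L_skew.
have MEskew t u : (JtensL L *m E t u)^T = - (JtensL L *m E t u).
  exact: JtensL_Emx_skew.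
split=> [y ysol|N y _ h step k kN]; last first.
  exact: skew_flow_midpoint_invariant Msym MEskew (step k kN).
have cst s t : t0 < s <= T -> t0 < t <= T -> qcharge L (y s) = qcharge L (y t).
  move=> sT tT; congr (_ * _).
  exact: (skew_flow_invariant _ _ _ _ _ _ _ Msym MEskew ysol).
split=> // yt0 t; rewrite le_eqVlt => /andP[/predU1P[<-//|tt0] tT].
(* [solution] says nothing at [t0]. Under right continuity the charge tends there to its value at
   [y t0]; being constant on []t0, T]], it also tends to its value at [y t], and limits are
   unique. *)
have qt0 : qcharge L (y s) @[s --> t0^'+] --> qcharge L (y t0).
  by apply: cvgM; [exact: cvg_cst|exact: cvg_form].
have qt : qcharge L (y s) @[s --> t0^'+] --> qcharge L (y t).
  apply: cvg_near_cst; near=> s; apply: cst; last by rewrite tt0.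
  by apply/andP; split; near: s; [exact: nbhs_right_gt|exact: nbhs_right_le].
exact: (cvg_unique _ qt qt0).
Unshelve. all: by end_near. Qed.
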